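(* For every real number $\mu>0$, the Lie algebra $\mathfrak{e}(\mu)$ admits an incomplete Lorentzian metric.
   Context: For $\mu>0$, $\mathfrak{e}(\mu)$ is the real 3-dimensional Lie algebra with basis $\{e_1,e_2,e_3\}$ and bracket relations $[e_1,e_2]=\mu e_2+e_3$, $[e_1,e_3]=\mu e_3-e_2$, $[e_2,e_3]=0$. A Lorentzian metric on a 3-dimensional real Lie algebra $\mathfrak{g}$ is a non-degenerate symmetric bilinear form $q$ on $\mathfrak{g}$ of signature $(+,+,-)$. The geodesic field of $(\mathfrak{g},q)$ is the quadratic vector field $F$ on $\mathfrak{g}$ given by $F(v)=\mathrm{ad}^\dagger_v v$, where $\mathrm{ad}^\dagger_v$ is the $q$-transpose of $\mathrm{ad}_v$; that is, $q(F(v),w)=q(v,[v,w])$ for all $v,w\in\mathfrak{g}$. $(\mathfrak{g},q)$ (or simply $q$) is called (geodesically) complete if the left-invariant metric defined by $q$ on a Lie group $G$ with Lie algebra $\mathfrak{g}$ is geodesically complete; equivalently (Euler–Arnold), if the geodesic field is a complete vector field, i.e. all maximal solutions of $\dot v=F(v)$ are defined on all of $\mathbb{R}$. Otherwise $q$ is incomplete. *)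

(* Defs.v *)
From HB Require Import structures.
From mathcomp Require Import all_boot all_order all_algebra.
From mathcomp Require Import all_classical all_reals all_analysis.
From mathcomp Require Import ring.

Set Implicit Arguments.
Unset Strict Implicit.
Unset Printing Implicit Defensive.

Import Order.TTheory GRing.Theory Num.Theory.
Import numFieldNormedType.Exports.

Local Open Scope classical_set_scope.
Local Open Scope ring_scope.

Record lie_bracket (R : realType) (br : 'rV[R]_3 -> 'rV[R]_3 -> 'rV[R]_3) :
    Prop := LieBracket {
  lie_linearl : forall v, linear (br^~ v) ;
  lie_linearr : forall v, linear (br v) ;
  lie_alt : forall v, br v v = 0 ;
  lie_jacobi : forall u v w, br u (br v w) + br v (br w u) + br w (br u v) = 0
}.

(* The basis (e_1, e_2, e_3) of e(mu) is ('e_0, 'e_1, 'e_2), so x 0 i is the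
   coefficient of x on e_(i+1). *)
Definition e_bracket (R : realType) (mu : R) (x y : 'rV[R]_3) : 'rV[R]_3 :=
  (x 0 0 * y 0 1 - x 0 1 * y 0 0) *: (mu *: 'e_1 + 'e_2)
  + (x 0 0 * y 0 2 - x 0 2 * y 0 0) *: (mu *: 'e_2 - 'e_1).

Lemma e_bracket12 (R : realType) (mu : R) :
  e_bracket mu 'e_0 'e_1 = mu *: 'e_1 + 'e_2.
Proof.
by rewrite /e_bracket !mxE /= !(mulr0, mul0r, mulr1) !subr0 scale1r scale0r addr0.
Qed.

Lemma e_bracket13 (R : realType) (mu : R) :
  e_bracket mu 'e_0 'e_2 = mu *: 'e_2 - 'e_1.
Proof.
by rewrite /e_bracket !mxE /= !(mulr0, mul0r, mulr1) !subr0 scale1r scale0r add0r.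
Qed.

Lemma e_bracket23 (R : realType) (mu : R) : e_bracket mu 'e_1 'e_2 = 0.
Proof.
by rewrite /e_bracket !mxE /= !(mulr0, mul0r, mulr1) !subr0 !scale0r addr0.
Qed.

Lemma e_bracket_lie (R : realType) (mu : R) : lie_bracket (e_bracket mu).
Proof.
split.
- by move=> v a x y; apply/rowP => i; rewrite /e_bracket !mxE; ring.
- by move=> v a x y; apply/rowP => i; rewrite /e_bracket !mxE; ring.
- by move=> v; apply/rowP => i; rewrite /e_bracket !mxE; ring.
- by move=> u v w; apply/rowP => i; rewrite /e_bracket !mxE /=; ring.
Qed.

Definition signature_ppm (R : realType) (q : {symmetric 'rV[R]_3}) : Prop :=
  exists b : 3.-tuple 'rV[R]_3,
    [/\ basis_of fullv b,
        forall i j : 'I_3, i != j -> q b`_i b`_j = 0,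
        0 < q b`_0 b`_0, 0 < q b`_1 b`_1 & q b`_2 b`_2 < 0].

Definition lorentzian (R : realType) (q : {symmetric 'rV[R]_3}) : Prop :=
  nondegenerate q /\ signature_ppm q.

(* The value is meaningful when q is nondegenerate and f is linear: it is then
   the only y with q y w = q x (f w) for all w, see adjointP and adjoint_uniq. *)
Definition adjoint (R : realType) (q : {symmetric 'rV[R]_3})
    (f : 'rV[R]_3 -> 'rV[R]_3) (x : 'rV[R]_3) : 'rV[R]_3 :=
  xget 0 [set y | forall w, q y w = q x (f w)].

Definition geodesic_field (R : realType)
    (br : 'rV[R]_3 -> 'rV[R]_3 -> 'rV[R]_3) (q : {symmetric 'rV[R]_3})
    (v : 'rV[R]_3) : 'rV[R]_3 :=
  adjoint q (br v) v.

Lemma nondegenerate_inj (R : realType) (q : {symmetric 'rV[R]_3})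
    (y z : 'rV[R]_3) :
  nondegenerate q -> (forall w, q y w = q z w) -> y = z.
Proof.
move=> /eqP q0 yz; apply/eqP; rewrite -subr_eq0 -memv0 -q0.
apply: (subvP _ _ (memv_line (y - z))).
apply/orthovP => _ w /vlineP[k ->] _.
by rewrite linearZl_LR linearBl /= yz subrr mulr0.
Qed.

Lemma adjoint_uniq (R : realType) (q : {symmetric 'rV[R]_3})
    (f : 'rV[R]_3 -> 'rV[R]_3) (x y : 'rV[R]_3) :
  nondegenerate q -> (forall w, q y w = q x (f w)) -> adjoint q f x = y.
Proof.
move=> q0 qy; apply: xget_unique => // z qz.
by apply: (nondegenerate_inj q0) => w; rewrite qz qy.
Qed.

Lemma adjointP (R : realType) (q : {symmetric 'rV[R]_3})
    (f : 'rV[R]_3 -> 'rV[R]_3) (x w : 'rV[R]_3) :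
  nondegenerate q -> linear f -> q (adjoint q f x) w = q x (f w).
Proof.
move=> q0 lf.
pose flM := GRing.isLinear.Build _ _ _ _ f lf.
pose fL : {linear 'rV[R]_3 -> 'rV[R]_3} := HB.pack f flM.
pose G : 'M[R]_3 := \matrix_(i, j) q 'e_i 'e_j.
have qE u v : q u v = \sum_j (u *m G) 0 j * v 0 j.
  rewrite [v in LHS]row_sum_delta linear_sumr /=; apply: eq_bigr => j _.
  rewrite linearZr /= [u in LHS]row_sum_delta linear_sumlz mxE mulrC.
  by congr (_ * _); apply: eq_bigr => i _; rewrite linearZl_LR /= mxE.
have Gu : G \in unitmx.
  rewrite -row_free_unit -kermx_eq0; apply/rowV0P => y /sub_kermxP yG.
  apply: (nondegenerate_inj q0) => z; rewrite linear0l qE yG.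
  by apply: big1 => j _; rewrite mxE mul0r.
pose l : 'rV[R]_3 := \row_j q x (f 'e_j).
have lE u : q (l *m invmx G) u = q x (f u).
  rewrite qE mulmxKV //.
  have -> : f u = \sum_j u 0 j *: f 'e_j.
    rewrite [in LHS](row_sum_delta u) -[f _]/(fL _) linear_sum.
    by apply: eq_bigr => j _; rewrite linearZ.
  rewrite linear_sumr; apply: eq_bigr => j _.
  by rewrite linearZr_LR /= mxE mulrC.
by rewrite (adjoint_uniq q0 lE).
Qed.

Lemma geodesic_fieldP (R : realType) (br : 'rV[R]_3 -> 'rV[R]_3 -> 'rV[R]_3)
    (q : {symmetric 'rV[R]_3}) (v w : 'rV[R]_3) :
  lie_bracket br -> nondegenerate q ->
  q (geodesic_field br q v) w = q v (br v w).
Proof. by move=> brL q0; apply: adjointP => //; exact: lie_linearr. Qed.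

Definition integral_curve (R : realType) (F : 'rV[R]_3 -> 'rV[R]_3)
    (I : set R) (g : R -> 'rV[R]_3) : Prop :=
  [/\ open I, is_interval I, I !=set0 &
      forall t, I t -> is_derive t 1 g (F (g t))].

(* Only the restriction of g to I matters. *)
Definition maximal_integral_curve (R : realType) (F : 'rV[R]_3 -> 'rV[R]_3)
    (I : set R) (g : R -> 'rV[R]_3) : Prop :=
  integral_curve F I g /\
  forall (J : set R) (h : R -> 'rV[R]_3), integral_curve F J h ->
    I `<=` J -> (forall t, I t -> h t = g t) -> J = I.

Definition complete_field (R : realType) (F : 'rV[R]_3 -> 'rV[R]_3) : Prop :=
  forall (I : set R) (g : R -> 'rV[R]_3),
    maximal_integral_curve F I g -> I = setT.

(* Euler-Arnold: the left-invariant metric given by q on a Lie group with Lie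
   algebra ('rV[R]_3, br) is geodesically complete iff the geodesic field is. *)
Definition geodesically_complete (R : realType)
    (br : 'rV[R]_3 -> 'rV[R]_3 -> 'rV[R]_3) (q : {symmetric 'rV[R]_3}) : Prop :=
  complete_field (geodesic_field br q).

(* Main.v *)
Require Import Defs.
From HB Require Import structures.
From mathcomp Require Import all_boot all_order all_algebra.
From mathcomp Require Import all_classical all_reals all_analysis.
From mathcomp Require Import ring lra.

Set Implicit Arguments.
Unset Strict Implicit.
Unset Printing Implicit Defensive.

Import Order.TTheory GRing.Theory Num.Theory.
Import numFieldNormedType.Exports.
Local Open Scope classical_set_scope.
Local Open Scope ring_scope.

(** For the form [-x_1^2 + x_2^2 + x_3^2] and [v = a e_1 + w], with [w] in the
    abelian ideal spanned by [e_2, e_3] and [A] the action of [e_1] on it, the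
    geodesic equations are [a' = mu |w|^2] and [w' = a A^T w].  On the null cone
    [a = |w|] they give [a' = mu a^2] while [w] rotates at angular speed [a].  So
    [a t = 1 / (1 - mu t)], with angle [- ln (1 - mu t) / mu], is a solution that
    blows up at [t = 1 / mu]. *)

Lemma ord3P (P : 'I_3 -> Prop) : P 0 -> P 1 -> P 2 -> forall i, P i.
Proof.
move=> P0 P1 P2 [[|[|[|//]]] i3].
- by rewrite (_ : Ordinal i3 = 0) //; apply: val_inj.
- by rewrite (_ : Ordinal i3 = 1) //; apply: val_inj.
- by rewrite (_ : Ordinal i3 = 2) //; apply: val_inj.
Qed.

Lemma is_derive_mx (R : realFieldType) (V : normedModType R) (m n : nat)
    (M : V -> 'M[R]_(m, n)) (dM : 'M[R]_(m, n)) (t v : V) :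
  (forall i j, is_derive t v (fun x => M x i j) (dM i j)) ->
  is_derive t v M dM.
Proof.
move=> Mij.
have Mtv : derivable M t v by apply/derivable_mxP => i j; have [] := Mij i j.
split=> //; rewrite derive_mx //; apply/matrixP => i j; rewrite mxE.
by have [] := Mij i j.
Qed.

Section minkowski.
Variable R : realType.

Definition minkowski (u v : 'rV[R]_3) : R :=
  - (u 0 0 * v 0 0) + u 0 1 * v 0 1 + u 0 2 * v 0 2.

Lemma minkowski_bilinear : bilinear_for *%R *%R minkowski.
Proof. by split=> u a x y; rewrite /minkowski !mxE /=; ring. Qed.

(** Stated in the shape of the Hermitian interface, where sign exponent [false] and conjugation
    [idfun] encode a symmetric form. *)
Lemma minkowski_sym (u v : 'rV[R]_3) :
  minkowski u v = (-1) ^+ false * idfun (minkowski v u).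
Proof. by rewrite mul1r /minkowski /=; ring. Qed.

HB.instance Definition _ :=
  bilinear_isBilinear.Build R _ _ _ *%R (idfun \; *%R) minkowski
    minkowski_bilinear.
HB.instance Definition _ :=
  isHermitianSesquilinear.Build R _ false idfun minkowski minkowski_sym.

Definition minkowski_form : {symmetric 'rV[R]_3} := minkowski.

Lemma minkowski_nondegenerate : nondegenerate minkowski_form.
Proof.
rewrite /nondegenerate -subv0; apply/subvP => u /mem_orthovP u0.
have {}u0 w : minkowski u w = 0 by apply: u0; rewrite memvf.
rewrite memv0; apply/eqP/rowP.
by apply: ord3P; [move: (u0 'e_0) | move: (u0 'e_1) | move: (u0 'e_2)];
  rewrite /minkowski !mxE /= => ?; lra.
Qed.

Lemma minkowski_signature : signature_ppm minkowski_form.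
Proof.
(* [signature_ppm] wants the negative vector last, hence the timelike ['e_0] closes the tuple. *)
exists [tuple 'e_1; 'e_2; 'e_0]; split.
- rewrite basisEdim; apply/andP; split; last by rewrite dimvf.
  apply/subvP => u _; rewrite (row_sum_delta u); apply: memv_suml => i _.
  by apply/memvZ/memv_span; move: i; apply: ord3P;
    rewrite !inE eqxx ?orbT.
- by do 2![apply: ord3P] => //= _; rewrite /minkowski !mxE /=; ring.
- by rewrite /= /minkowski !mxE /=; lra.
- by rewrite /= /minkowski !mxE /=; lra.
- by rewrite /= /minkowski !mxE /=; lra.
Qed.

End minkowski.

(** The standard basis is orthonormal up to sign, so testing the identity that defines the field
    against each basis vector isolates one coordinate. *)
Lemma geodesic_field_minkowski (R : realType) (mu : R) (v : 'rV[R]_3) :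
  let F := geodesic_field (e_bracket mu) (minkowski_form R) v in
  [/\ F 0 0 = mu * (v 0 1 ^+ 2 + v 0 2 ^+ 2),
      F 0 1 = v 0 0 * (mu * v 0 1 + v 0 2) &
      F 0 2 = v 0 0 * (mu * v 0 2 - v 0 1)].
Proof.
move=> F.
have FE w : minkowski F w = minkowski v (e_bracket mu v w).
  exact: geodesic_fieldP (e_bracket_lie mu) (minkowski_nondegenerate R).
by split; [move: (FE 'e_0) | move: (FE 'e_1) | move: (FE 'e_2)];
  rewrite /minkowski /e_bracket !mxE /= => ?; lra.
Qed.

Section spiral.
Variables (R : realType) (mu : R).

(** Here [s] is the primitive of [r] that vanishes at [0]. The minus sign before [sin] is the sense
    of rotation: the transposed action turns ['e_1] towards [- 'e_2]. Only times below [mu^-1]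
    matter. *)
Definition spiral (t : R) : 'rV[R]_3 :=
  let r := (1 - mu * t)^-1 in
  let s := - (ln (1 - mu * t) / mu) in
  r *: ('e_0 + cos s *: 'e_1 - sin s *: 'e_2).

Lemma spiral0 (t : R) : spiral t 0 0 = (1 - mu * t)^-1.
Proof. by rewrite /spiral !mxE /=; ring. Qed.

Lemma spiral1 (t : R) :
  spiral t 0 1 = (1 - mu * t)^-1 * cos (- (ln (1 - mu * t) / mu)).
Proof. by rewrite /spiral !mxE /=; ring. Qed.

Lemma spiral2 (t : R) :
  spiral t 0 2 = - ((1 - mu * t)^-1 * sin (- (ln (1 - mu * t) / mu))).
Proof. by rewrite /spiral !mxE /=; ring. Qed.

Lemma spiral_is_derive (t : R) : 0 < mu -> t < mu^-1 ->
  is_derive t 1 spiral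
    (geodesic_field (e_bracket mu) (minkowski_form R) (spiral t)).
Proof.
move=> mu0 tmu.
have d0 : 0 < 1 - mu * t by rewrite subr_gt0 -ltr_pdivlMl // mulr1.
have dN0 : 1 - mu * t != 0 by rewrite gt_eqF.
have muN0 : mu != 0 by rewrite gt_eqF.
pose d (x : R) := 1 - mu * x.
pose r (x : R) := (d x)^-1.
pose s (x : R) := - (ln (d x) / mu).
have dD : is_derive t 1 d (- mu).
  have : is_derive t 1 d (0 - mu *: 1) by apply: is_deriveB.
  by move/is_derive_eq; apply; rewrite sub0r scaler1.
have rD : is_derive t 1 r (mu * r t ^+ 2).
  apply: is_derive_eq; first exact: is_deriveV.
  by rewrite /r -[LHS]/(_ * _) mulrNN exprVn mulrC.
have lnD : is_derive t 1 (@ln R \o d) (- mu * (d t)^-1).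
  apply: is_derive_eq; first by apply: is_derive1_comp; exact: is_derive1_ln.
  by rewrite /= mulrC.
(* The angular speed equals the first coordinate [r]; this and [r' = mu * r ^+ 2] are all that the
   product rule needs below. *)
have sD : is_derive t 1 s (r t).
  have : is_derive t 1 s (- mu^-1 *: (- mu * (d t)^-1)).
    rewrite (_ : s = - mu^-1 \*: (@ln R \o d)); first exact: is_deriveZ.
    by apply/funext => x; rewrite /s /= -[RHS]/(_ * _) mulNr mulrC.
  by move/is_derive_eq; apply; rewrite -[LHS]/(_ * _) mulrA mulrNN mulVf ?mul1r.
have cosD : is_derive t 1 (@cos R \o s) (- sin (s t) * r t)
  by exact: is_derive1_comp.
have sinD : is_derive t 1 (@sin R \o s) (cos (s t) * r t)
  by exact: is_derive1_comp.
have [F0 F1 F2] := geodesic_field_minkowski mu (spiral t).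
have cs := cos2Dsin2 (s t).
apply: is_derive_mx => i j; rewrite (ord1 i); move: j; apply: ord3P.
- rewrite F0 (_ : (fun x => _) = r); last by apply/funext => x; exact: spiral0.
  apply: (is_derive_eq rD).
  rewrite spiral1 spiral2 -/(d t) -/(r t) -/(s t).
  (* Nullness enters here: the factor [1] becomes [cos ^+ 2 + sin ^+ 2], turning [r ^+ 2] into the
     squared norm of the part in the ideal. *)
  by rewrite -[LHS]mulr1 -cs; ring.
- rewrite F1 (_ : (fun x => _) = r * (@cos R \o s)); last first.
    by apply/funext => x; exact: spiral1.
  apply: (is_derive_eq (is_deriveM rD cosD)).
  rewrite spiral0 spiral1 spiral2 -/(d t) -/(r t) -/(s t) /GRing.scale /=.
  by ring.
- rewrite F2 (_ : (fun x => _) = - (r * (@sin R \o s))); last first.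
    by apply/funext => x; exact: spiral2.
  apply: (is_derive_eq (is_deriveN (is_deriveM rD sinD))).
  rewrite spiral0 spiral1 spiral2 -/(d t) -/(r t) -/(s t) /GRing.scale /=.
  by ring.
Qed.

End spiral.

Lemma spiral_maximal (R : realType) (mu : R) : 0 < mu ->
  maximal_integral_curve (geodesic_field (e_bracket mu) (minkowski_form R))
    [set t | t < mu^-1] (spiral mu).
Proof.
move=> mu0; have T0 : 0 < mu^-1 by rewrite invr_gt0.
split.
  split=> [||| t]; last exact: spiral_is_derive.
  - exact: open_lt.
  - by move=> x y _ yT z /andP[_ zy]; exact: le_lt_trans zy yT.
  - by exists 0.
move=> J h [_ Jitv _ hD] IJ hE; apply/seteqP; split=> // t Jt /=.
rewrite ltNge; apply/negP => Tt.
(* The interval [J] contains [0] and some [t >= mu^-1], hence the blow-up time itself. *)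
have JT : J mu^-1 by apply: (Jitv 0 t) => //; [exact: IJ | rewrite ltW].
(* Multiplying by [1 - mu * x] cancels the pole: [phi] is constantly [1] just left of [mu^-1], yet
   continuity of [h] at [mu^-1] forces the limit [phi mu^-1 = 0]. *)
pose phi (x : R) := h x 0 0 * (1 - mu * x).
have phic : phi x @[x --> mu^-1] --> phi mu^-1.
  apply: cvgM.
    have [/derivable_mxP/(_ 0 0)/derivable1_diffP + _] := hD _ JT.
    exact: differentiable_continuous.
  by apply: cvgB; [exact: cvg_cst | apply: cvgM; [exact: cvg_cst | exact: cvg_id]].
have phi1 : phi x @[x --> mu^-1^'-] --> (1 : R).
  apply: cvg_near_cst; near=> x.
  have xT : x < mu^-1 by near: x; exact: nbhs_left_lt.
  rewrite /phi hE // spiral0 mulVf // subr_eq0 eq_sym lt_eqF //.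
  by rewrite -ltr_pdivlMl // mulr1.
have phiT1 : phi mu^-1 = 1.
  by apply: cvg_unique phi1; [exact: Rhausdorff | exact: cvg_at_left_filter].
have phiT0 : phi mu^-1 = 0.
  by rewrite /phi divff ?subrr ?mulr0 // gt_eqF.
by have := oner_neq0 R; rewrite -{1}phiT1 phiT0 eqxx.
Unshelve. all: by end_near. Qed.

Theorem proposition8p1 (R : realType) (mu : R) (mu_gt0 : 0 < mu) :
  exists q : {symmetric 'rV[R]_3},
    lorentzian q /\ ~ geodesically_complete (e_bracket mu) q.
Proof.
exists (minkowski_form R); split.
  by split; [exact: minkowski_nondegenerate | exact: minkowski_signature].
(* Completeness would make the domain [setT], putting [mu^-1] below itself. *)
move=> /(_ _ _ (spiral_maximal mu_gt0)) /seteqP[_ /(_ mu^-1 I)].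
by rewrite /= ltxx.
Qed.
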